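(* There is a universal constant $C>0$ such that the following holds for every $n\ge 2$. Let $A\in\mathbb{R}^{m\times n}$ with $\mathrm{rk}(A)=m$, $b\in\mathbb{R}^m$, $c\in\mathbb{R}^n$, and suppose the linear program $\min\{\langle c,x\rangle : Ax=b,\ x\ge \mathbf 0\}$ is bounded (feasible with finite optimal value, with its max central path $x^{\mathfrak m}$ well defined). Let $P$ be its feasible region and $F^*$ its optimal face. For any $x\in P$ with optimality gap $g\ge 0$, the length of a shortest circuit walk from $x$ to (a point of) $F^*$ is at most $$C\, n^2\log(n)\sum_{i=1}^n \mathrm{SLC}_{1/2}(x^{\mathfrak m}_i,g).$$
   Context: Notation for the LP $\min\{\langle c,x\rangle: Ax=b,\ x\ge\mathbf 0\}$ with feasible region $P$ and optimal value $v^*$: the optimality gap of $x\in P$ is $\langle c,x\rangle-v^*$. The optimal face $F^*$ is the set of optimal solutions. Circuits: an elementary vector of $A$ is a vector $h\in\ker(A)\setminus\{\mathbf 0\}$ of inclusion-minimal support among nonzero vectors of $\ker(A)$; $\mathcal E(A)$ is the set of elementary vectors. A circuit walk is a sequence $x^{(0)},x^{(1)},\dots,x^{(T)}$ in $P$ such that for each $t$ we have $x^{(t+1)}=x^{(t)}+\alpha h$ for some $h\in\mathcal E(A)$, where $\alpha>0$ is the maximal step size with $x^{(t)}+\alpha h\in P$. Its length is the number of steps $T$. Max central path: for $g\ge0$ let $P_g=\{x\in P:\langle c,x\rangle\le v^*+g\}$, assumed bounded. The max central path is $x^{\mathfrak m}:\mathbb{R}_{\ge0}\to\mathbb{R}^n_{\ge0}$,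 $x^{\mathfrak m}_i(g)=\max\{x_i:x\in P_g\}$. Straight line complexity: for $\phi:\mathbb{R}_{\ge0}\to\mathbb{R}_{\ge0}$, $\eta\in(0,1]$ and $g\ge0$, $\mathrm{SLC}_\eta(\phi,g)$ is the minimum number of pieces of a continuous piecewise linear function $\psi:[0,g]\to\mathbb{R}_{\ge0}$ with $\eta\phi\le\psi\le\phi$ on $[0,g]$. *)

(* Defs.v *)
From mathcomp Require Import all_boot all_order all_algebra.
From mathcomp Require Import all_classical all_reals all_analysis.
Import Order.TTheory GRing.Theory Num.Theory.
Import numFieldNormedType.Exports.

Set Implicit Arguments.
Unset Strict Implicit.
Unset Printing Implicit Defensive.

Local Open Scope classical_set_scope.
Local Open Scope ring_scope.

Definition dotp (R : realType) (n : nat) (c x : 'cV[R]_n) : R :=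
  \sum_(i < n) c i 0 * x i 0.

Definition feasible (R : realType) (m n : nat) (A : 'M[R]_(m, n))
    (b : 'cV[R]_m) : set 'cV[R]_n :=
  [set x | A *m x = b /\ forall i, 0 <= x i 0].

Definition lp_values (R : realType) (m n : nat) (A : 'M[R]_(m, n))
    (b : 'cV[R]_m) (c : 'cV[R]_n) : set R :=
  [set dotp c x | x in feasible A b].

Definition lp_bounded (R : realType) (m n : nat) (A : 'M[R]_(m, n))
    (b : 'cV[R]_m) (c : 'cV[R]_n) : Prop :=
  has_inf (lp_values A b c).

Definition opt_value (R : realType) (m n : nat) (A : 'M[R]_(m, n))
    (b : 'cV[R]_m) (c : 'cV[R]_n) : R :=
  inf (lp_values A b c).

Definition opt_gap (R : realType) (m n : nat) (A : 'M[R]_(m, n))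
    (b : 'cV[R]_m) (c x : 'cV[R]_n) : R :=
  dotp c x - opt_value A b c.

Definition opt_face (R : realType) (m n : nat) (A : 'M[R]_(m, n))
    (b : 'cV[R]_m) (c : 'cV[R]_n) : set 'cV[R]_n :=
  [set x | feasible A b x /\
           forall y, feasible A b y -> dotp c x <= dotp c y].

Definition supp (R : realType) (n : nat) (h : 'cV[R]_n) : {pred 'I_n} :=
  [pred i | h i 0 != 0].

Definition elementary (R : realType) (m n : nat) (A : 'M[R]_(m, n)) :
    set 'cV[R]_n :=
  [set h | [/\ A *m h = 0, h != 0 &
     forall k : 'cV[R]_n, A *m k = 0 -> k != 0 -> ~~ (supp k \proper supp h)]].

(* There is no step along [h] when [x + alpha h] stays feasible for all
   [alpha >= 0], since then no maximal step size exists. *)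
Definition circuit_step (R : realType) (m n : nat) (A : 'M[R]_(m, n))
    (b : 'cV[R]_m) (x y : 'cV[R]_n) : Prop :=
  exists (h : 'cV[R]_n) (alpha : R),
    [/\ elementary A h, 0 < alpha, feasible A b (x + alpha *: h),
        (forall beta : R, feasible A b (x + beta *: h) -> beta <= alpha) &
        y = x + alpha *: h].

(* Only [w 0], ..., [w T] are relevant; the length of the walk is [T]. *)
Definition circuit_walk (R : realType) (m n : nat) (A : 'M[R]_(m, n))
    (b : 'cV[R]_m) (T : nat) (w : nat -> 'cV[R]_n) : Prop :=
  (forall t, (t <= T)%N -> feasible A b (w t)) /\
  (forall t, (t < T)%N -> circuit_step A b (w t) (w t.+1)).

Definition gap_sublevel (R : realType) (m n : nat) (A : 'M[R]_(m, n))
    (b : 'cV[R]_m) (c : 'cV[R]_n) (g : R) : set 'cV[R]_n :=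
  [set x | feasible A b x /\ dotp c x <= opt_value A b c + g].

(* For [g >= 0] the set [gap_sublevel A b c g] is a closed polyhedron, nonempty
   if the program is bounded; if it is moreover bounded, the supremum is a
   maximum. *)
Definition max_central_path (R : realType) (m n : nat) (A : 'M[R]_(m, n))
    (b : 'cV[R]_m) (c : 'cV[R]_n) (i : 'I_n) (g : R) : R :=
  sup [set x i 0 | x in gap_sublevel A b c g].

(* Consecutive breakpoints may coincide, so that [[0, 0]] is covered by one
   piece; for [g > 0] this does not affect the minimum number of pieces. *)
Definition piecewise_linear (R : realType) (g : R) (p : nat) (psi : R -> R) :
    Prop :=
  (0 < p)%N /\
  exists t : nat -> R,
    [/\ t 0%N = 0, t p = g, (forall k, (k < p)%N -> t k <= t k.+1) &
        forall k, (k < p)%N -> exists u v : R,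
          forall s, t k <= s <= t k.+1 -> psi s = u * s + v].

Definition slc_pieces (R : realType) (eta : R) (phi : R -> R) (g : R) :
    set nat :=
  [set p | exists psi : R -> R,
     [/\ {within `[0, g], continuous psi}, piecewise_linear g p psi,
         (forall s, 0 <= s <= g -> 0 <= psi s) &
         forall s, 0 <= s <= g -> eta * phi s <= psi s <= phi s]].

(* A minimum over natural numbers, with value [+oo] if no number of pieces
   suffices. *)
Definition SLC (R : realType) (eta : R) (phi : R -> R) (g : R) : \bar R :=
  ereal_inf [set (p%:R)%:E | p in slc_pieces eta phi g].

(* Main.v *)
(* The number of steps is in fact O(n^2 log n), with no dependence on the
   central path: each SLC is at least 1, as a piecewise linear function has at
   least one piece.
   Fix an optimal point y and K = 2n. If some coordinate has x_i > 2K y_i, aim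
   at the infeasible point z = y - (x - y)/K slightly beyond y, with z_i < 0.
   A circuit conformal to z - x that makes at least a 1/n fraction of the
   progress in coordinate i can be blocked at a step length below 1 only by a
   coordinate j with z_j < 0; otherwise x_i - z_i shrinks by a factor 1 - 1/n.
   As x_i cannot become negative, within O(n log n) steps some coordinate with
   x_j > K y_j reaches 0. Conformality, with step lengths at most n, preserves
   every inequality x_j <= K y_j, so there are at most n such phases. Then
   x <= 2K y, and x is optimal because y is. *)
Require Import Defs.
From mathcomp Require Import all_boot all_order all_algebra.
From mathcomp Require Import all_classical all_reals all_analysis.
From mathcomp Require Import ring lra.
Import Order.TTheory GRing.Theory Num.Theory.
Import numFieldNormedType.Exports.

Local Open Scope classical_set_scope.
Local Open Scope ring_scope.

(** * Conformal and sign-compatible vectors *)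

Definition between {R : realType} (a d : R) : bool :=
  (0 <= a <= d) || (d <= a <= 0).

(** Besides agreeing in sign, [h] is bounded by [d] entrywise in absolute value, so [x + h] lies in
    the box spanned by [x] and [x + d]. *)
Definition conformal {R : realType} {n : nat} (h d : 'cV[R]_n) : Prop :=
  forall i, between (h i 0) (d i 0).

Lemma between_sub {R : realType} (a d : R) : between a d -> between (d - a) d.
Proof. by rewrite /between => /orP[]/andP[? ?]; apply/orP; [left|right]; lra. Qed.

Lemma between_trans {R : realType} (a b d : R) :
  between a b -> between b d -> between a d.
Proof.
by rewrite /between => /orP[]/andP[? ?] /orP[]/andP[? ?]; apply/orP;
  solve [left; lra|right; lra].
Qed.

Lemma conformal_trans {R : realType} {n : nat} (h k d : 'cV[R]_n) :
  conformal h k -> conformal k d -> conformal h d.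
Proof. by move=> hk kd i; exact: between_trans (hk i) (kd i). Qed.

Lemma conformal_sub {R : realType} {n : nat} (h d : 'cV[R]_n) :
  conformal h d -> conformal (d - h) d.
Proof. by move=> hd i; rewrite !mxE; exact: between_sub. Qed.


(** The scale-free form of conformality: supports are nested and signs agree, but magnitudes are
    free. *)
Definition sign_sub {R : realType} {n : nat} (h d : 'cV[R]_n) : Prop :=
  forall i, 0 <= h i 0 * d i 0 /\ (d i 0 = 0 -> h i 0 = 0).

Lemma sign_sub_trans {R : realType} {n : nat} (h k d : 'cV[R]_n) :
  sign_sub h k -> sign_sub k d -> sign_sub h d.
Proof.
move=> hk kd i; have [hk1 hk2] := hk i; have [kd1 kd2] := kd i.
split=> [|/kd2/hk2//].
have [k0|k0] := eqVneq (k i 0) 0; first by rewrite hk2// mul0r.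
rewrite -(pmulr_lge0 _ (_ : 0 < k i 0 ^+ 2)) ?exprn_even_gt0//.
have -> : h i 0 * d i 0 * k i 0 ^+ 2 = (h i 0 * k i 0) * (k i 0 * d i 0) by ring.
exact: mulr_ge0.
Qed.

Lemma conformal_sign_sub {R : realType} {n : nat} (h d : 'cV[R]_n) :
  conformal h d -> sign_sub h d.
Proof.
move=> hd i; move: (hd i); rewrite /between => /orP[]/andP[? ?]; split; nra.
Qed.

Lemma card_supp_sub {R : realType} {n : nat} (h d : 'cV[R]_n) (j : 'I_n) :
  sign_sub h d -> d j 0 != 0 -> h j 0 = 0 -> (#|supp h| < #|supp d|)%N.
Proof.
move=> hd dj hj; apply: proper_card; apply/properP; split.
  apply/fintype.subsetP => i; rewrite !inE; apply: contra => /eqP di.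
  by have [_ /(_ di)/eqP] := hd i.
by exists j; rewrite !inE ?hj ?eqxx.
Qed.

(** * Elementary vectors conformal to a kernel vector *)

(** The ratio test: [l] is the least [d i 0 / k i 0] over the coordinates where [d] and [k] agree in
    sign, so [d - l *: k] vanishes at a minimiser and reverses sign at none of them. *)
Lemma min_ratio {R : realType} {n : nat} (d k : 'cV[R]_n) (j : 'I_n) :
  0 < d j 0 * k j 0 ->
  exists l : R, [/\ 0 < l,
    exists2 i, d i 0 != 0 & d i 0 = l * k i 0 &
    forall i, 0 < d i 0 * k i 0 -> between (l * k i 0) (d i 0)].
Proof.
move=> djk.
pose P := [pred i | 0 < d i 0 * k i 0].
have Pj : P j by [].
case: (arg_minP (fun i => d i 0 / k i 0) Pj) => i Pi imin.
have nz i' : P i' -> d i' 0 != 0 /\ k i' 0 != 0.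
  by rewrite /= => /gt_eqF/negbT; rewrite mulf_eq0 negb_or => /andP.
have [di ki] := nz _ Pi.
have l0 : 0 < d i 0 / k i 0.
  have -> : d i 0 / k i 0 = (d i 0 * k i 0) / (k i 0 ^+ 2) by field.
  by rewrite divr_gt0// exprn_even_gt0.
exists (d i 0 / k i 0); split => //; first by exists i => //; field.
move=> i' Pi'; have := imin _ Pi'; set l := d i 0 / k i 0 in l0 *.
have [di' ki'] := nz _ Pi'.
have E : d i' 0 = (d i' 0 / k i' 0) * k i' 0 by field.
rewrite {2}E; set r := _ / k i' 0 in E * => /= lr.
rewrite /between; case: (ltgtP (k i' 0) 0) ki' => // ki' _; apply/orP.
- by right; nra.
- by left; nra.
Qed.

(** Induction on the support: if [d] is not elementary, cancelling a coordinate against a kernel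
    vector of smaller support leaves a nonzero kernel vector with compatible signs and fewer nonzero
    entries. *)
Lemma elementary_sign_sub {R : realType} {m n : nat} (A : 'M[R]_(m, n))
    (d : 'cV[R]_n) :
  A *m d = 0 -> d != 0 -> exists2 h, elementary A h & sign_sub h d.
Proof.
have [N] := ubnP #|supp d|; elim: N d => // N IH d /ltnSE dN Ad d0.
have [de|nde] := pselect (elementary A d).
  exists d => // i; split => //; exact: sqr_ge0.
have [k0 [Ak0 k00 kd0]] : exists k : 'cV[R]_n, [/\ A *m k = 0, k != 0 &
    supp k \proper supp d].
  apply: contrapT => H; apply: nde; split=> // k Ak k0.
  by apply/negP => kd; apply: H; exists k.
have [j k0j] : exists j, k0 j 0 != 0.
  apply: contrapT => H; move/eqP: k00; apply; apply/colP => j; rewrite mxE.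
  by apply/eqP/negP => kj; apply: H; exists j; apply/negP.
have dj : d j 0 != 0.
  by have /fintype.subsetP/(_ j) := proper_sub kd0; rewrite !inE; apply.
(* Replacing [k0] by its negative if necessary makes it agree with [d] at [j], so that the ratio
   test applies. *)
have [k [Ak kd kj]] : exists k : 'cV[R]_n,
    [/\ A *m k = 0, supp k \proper supp d & 0 < d j 0 * k j 0].
  have [dkj|dkj] := ltP 0 (d j 0 * k0 j 0); first by exists k0.
  exists (- k0); split; rewrite ?mulmxN ?Ak0 ?oppr0//.
    by rewrite (eq_proper (B := supp k0))// => i; rewrite !inE mxE oppr_eq0.
  by rewrite mxE mulrN oppr_gt0 lt_neqAle dkj mulf_neq0.
have [l [l0 [i di dik] lbet]] := min_ratio _ _ _ kj.
have sub i' : d i' 0 = 0 -> k i' 0 = 0.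
  move=> di'; have /fintype.subsetP/(_ i') := proper_sub kd.
  by rewrite !inE di' eqxx; case: eqP => // _ /(_ isT).
have dkd : sign_sub (d - l *: k) d.
  move=> i'; rewrite !mxE; split; last by move=> di'; rewrite di' sub// mulr0 subrr.
  have [/lbet/between_sub|P'] := ltP 0 (d i' 0 * k i' 0).
    by rewrite /between => /orP[]/andP[? ?]; nra.
  have : l * (d i' 0 * k i' 0) <= 0 by rewrite pmulr_rle0.
  by have := sqr_ge0 (d i' 0); nra.
have [h he hd] : exists2 h, elementary A h & sign_sub h (d - l *: k).
  apply: IH.
  - apply: leq_trans dN; apply: card_supp_sub dkd di _.
    by rewrite !mxE -dik subrr.
  - by rewrite mulmxBr -scalemxAr Ad Ak scaler0 subr0.
  (* [k] vanishes somewhere on the support of [d], and there [d - l *: k] keeps the entry of [d]. *)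
  - have /properP[_ [i']] := kd; rewrite !inE => di' /negbNE/eqP ki'.
    apply: contraNneq di' => /colP/(_ i'); rewrite !mxE ki' mulr0 subr0 => ->//.
by exists h => //; exact: sign_sub_trans hd dkd.
Qed.

Lemma elementary_scale {R : realType} {m n : nat} (A : 'M[R]_(m, n))
    (h : 'cV[R]_n) (l : R) :
  l != 0 -> elementary A h -> elementary A (l *: h).
Proof.
move=> l0 [Ah h0 hmin]; split.
- by rewrite -scalemxAr Ah scaler0.
- by rewrite scaler_eq0 negb_or l0.
- move=> k Ak k0; rewrite (eq_proper_r (B := supp h)); first exact: hmin.
  by move=> i; rewrite !inE mxE mulf_eq0 (negbTE l0).
Qed.

(** Scaling a sign-compatible elementary vector by the ratio test makes it conformal and cancels a
    coordinate of [d]: one step of a conformal decomposition. *)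
Lemma elementary_conformal {R : realType} {m n : nat} (A : 'M[R]_(m, n))
    (d : 'cV[R]_n) :
  A *m d = 0 -> d != 0 -> exists h, [/\ elementary A h, conformal h d &
    (#|supp (d - h)| < #|supp d|)%N].
Proof.
move=> Ad d0; have [h he hd] := elementary_sign_sub A d Ad d0.
have [_ h0 _] := he.
have [j hj] : exists j, h j 0 != 0.
  apply: contrapT => H; move/eqP: h0; apply; apply/colP => j; rewrite mxE.
  by apply/eqP/negP => hj; apply: H; exists j; apply/negP.
have pos i : h i 0 != 0 -> 0 < d i 0 * h i 0.
  move=> hi; have [hd1 hd2] := hd i; rewrite mulrC lt_neqAle hd1 andbT eq_sym.
  by rewrite mulf_neq0//; apply: contraNneq hi => /hd2 ->.
have [l [l0 [i di dih] lbet]] := min_ratio _ _ _ (pos _ hj).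
have lhd : conformal (l *: h) d.
  move=> i'; rewrite mxE; have [->|/pos/lbet//] := eqVneq (h i' 0) 0.
  by rewrite mulr0 /between lexx andbT /= le_total.
exists (l *: h); split => //; first by apply: elementary_scale; rewrite ?gt_eqF.
apply: card_supp_sub di _; last by rewrite !mxE -dih subrr.
exact/conformal_sign_sub/conformal_sub.
Qed.

(* Averaging over a conformal circuit decomposition, which has at most
   [#|supp d|] terms. *)
Lemma elementary_average {R : realType} {m n : nat} (A : 'M[R]_(m, n))
    (d : 'cV[R]_n) (i : 'I_n) :
  A *m d = 0 -> d i 0 < 0 ->
  exists h, [/\ elementary A h, conformal h d & #|supp d|%:R * h i 0 <= d i 0].
Proof.
have [N] := ubnP #|supp d|; elim: N d => // N IH d /ltnSE dN Ad di.
have d0 : d != 0 by apply: contraTneq di => ->; rewrite mxE ltxx.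
have [h [he hd hs]] := elementary_conformal A d Ad d0.
have [hi|hi] := leP (#|supp d|%:R * h i 0) (d i 0); first by exists h.
have Ah : A *m h = 0 by case: he.
have s0 : 0 < #|supp d|%:R :> R by rewrite ltr0n (leq_trans _ hs).
have dhi : (d - h) i 0 < 0.
  have s1 : 1 <= #|supp d|%:R :> R by rewrite ler1n -(ltr0n R).
  by rewrite !mxE; move: (hd i) => /orP[]/andP[? ?]; nra.
have [k [ke kd ki]] : exists k, [/\ elementary A k, conformal k (d - h) &
    #|supp (d - h)|%:R * k i 0 <= (d - h) i 0].
  by apply: IH; rewrite ?(leq_trans hs)// mulmxBr Ad Ah subrr.
exists k; split => //; first exact: conformal_trans kd (conformal_sub _ _ hd).
have k0 : k i 0 <= 0.
  by move: (kd i); rewrite /between => /orP[]/andP[? ?] //; lra.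
(* With [s] the support size of [d], the failure of [h] leaves [d - h] with entry [i] below
   [(1 - 1/s) d_i] and at most [s - 1] nonzero entries, so [k] still achieves [d_i / s]. *)
have : #|supp (d - h)|.+1%:R <= #|supp d|%:R :> R by rewrite ler_nat.
move: ki; rewrite !mxE -natr1.
move: (#|supp d|%:R : R) (#|supp (d - h)|%:R : R) s0 hi => s s' s0 hi ki ss'.
have sk : (s - 1) * k i 0 <= s' * k i 0 by rewrite ler_wnM2r//; lra.
have dhi' : d i 0 - h i 0 < 0 by move: dhi; rewrite !mxE.
have s1 : 0 < s - 1 by nra.
rewrite -(ler_pM2l s1); have : s * ((s - 1) * k i 0) <= s * (d i 0 - h i 0).
  by rewrite ler_pM2l//; lra.
lra.
Qed.

(** * Maximal circuit steps *)

(** The step ends where the first decreasing coordinate reaches zero. One exists because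
    [h i 0 < 0], and the step is positive because all of them start positive. *)
Lemma max_step {R : realType} {m n : nat} (A : 'M[R]_(m, n)) (b : 'cV[R]_m)
    (x h : 'cV[R]_n) (i : 'I_n) :
  feasible A b x -> elementary A h -> h i 0 < 0 ->
  (forall j, h j 0 < 0 -> 0 < x j 0) ->
  exists a : R, [/\ 0 < a, circuit_step A b x (x + a *: h) &
    exists2 j, h j 0 < 0 & x j 0 + a * h j 0 = 0].
Proof.
move=> [Ax x0] he hi hx; have [Ah _ _] := he.
pose P := [pred j | h j 0 < 0].
case: (arg_minP (fun j => x j 0 / - h j 0) (hi : P i)) => j /= hj jmin.
exists (x j 0 / - h j 0).
have a0 : 0 < x j 0 / - h j 0 by rewrite divr_gt0 ?oppr_gt0 ?hx.
have xj : x j 0 + x j 0 / - h j 0 * h j 0 = 0 by field; rewrite lt_eqF.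
split => //; last by exists j.
exists h, (x j 0 / - h j 0); split => //.
  split; first by rewrite mulmxDr -scalemxAr Ax Ah scaler0 addr0.
  move=> i'; rewrite !mxE.
  have [hi'|hi'] := ltP (h i' 0) 0.
    by have := jmin _ hi'; rewrite ler_pdivlMr ?oppr_gt0// mulrN; lra.
  by rewrite addr_ge0// mulr_ge0// ltW.
move=> beta [_ /(_ j)]; rewrite !mxE => xbj.
by rewrite ler_pdivlMr ?oppr_gt0// mulrN; lra.
Qed.

(* Only a coordinate with [z j 0 < 0] can block a step of length less than 1
   towards [z]. *)
Lemma step_towards {R : realType} {m n : nat} (A : 'M[R]_(m, n)) (b : 'cV[R]_m)
    (x z : 'cV[R]_n) (i : 'I_n) :
  feasible A b x -> A *m z = b -> (forall j, z j 0 < 0 -> 0 < x j 0) ->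
  z i 0 < 0 ->
  exists y, [/\ circuit_step A b x y,
    (forall j, y j 0 <= Num.max (x j 0) (n%:R * z j 0)) &
    (exists2 j, z j 0 < 0 & y j 0 = 0) \/
    (forall j, z j 0 < 0 -> 0 < y j 0) /\
    n%:R * (y i 0 - z i 0) <= (n%:R - 1) * (x i 0 - z i 0)].
Proof.
move=> fx Az zx zi; have [Ax x0] := fx.
have Ad : A *m (z - x) = 0 by rewrite mulmxBr Az Ax subrr.
have di : (z - x) i 0 < 0 by rewrite !mxE; have := x0 i; lra.
have [h [he hd hi]] := elementary_average A _ _ Ad di.
have n0 : (0 < n)%N by apply: leq_ltn_trans (ltn_ord i).
have n1 : 1 <= n%:R :> R by rewrite ler1n.
have hi0 : h i 0 < 0.
  rewrite ltNge; apply/negP => h0; have := le_lt_trans hi di.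
  by rewrite ltNge mulr_ge0.
have {}hi : n%:R * h i 0 <= z i 0 - x i 0.
  move: hi; rewrite !mxE; apply: le_trans.
  by apply: ler_wnM2r; [exact: ltW|rewrite ler_nat (leq_trans (max_card _))// card_ord].
have hx j : h j 0 < 0 -> 0 < x j 0.
  move=> hj; have [/zx//|zj] := ltP (z j 0) 0.
  by move: (hd j); rewrite /between !mxE => /orP[]/andP[? ?]; lra.
have [a [a0 st [j hj xj]]] := max_step A b x h i fx he hi0 hx.
have [fy0 fyA] : feasible A b (x + a *: h).
  by case: st => h' [a' [_ _ ? _ ->]].
(* Since [n h_i <= z_i - x_i < - x_i], a step longer than [n] would make coordinate [i] negative. *)
have an : a <= n%:R.
  have := fyA i; rewrite !mxE => ?; rewrite leNgt; apply/negP => na.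
  have : a * h i 0 < n%:R * h i 0 by rewrite ltr_nM2r.
  lra.
exists (x + a *: h); split => // [j'|].
  rewrite !mxE le_max; move: (hd j'); rewrite /between !mxE.
  move=> /orP[]/andP[h1 h2]; apply/orP; last by left; nra.
  (* In a nondecreasing coordinate [0 <= x_j <= z_j], so [x_j + a (z_j - x_j)] is at most [a z_j] if
     [a >= 1] and at most [z_j] otherwise. *)
  have xj' := x0 j'.
  have ah : a * h j' 0 <= a * (z j' 0 - x j' 0) by rewrite ler_wpM2l// ltW.
  have [a1|a1] := leP 1 a.
    have : a * z j' 0 <= n%:R * z j' 0 by rewrite ler_wpM2r//; lra.
    by right; nra.
  right; have : z j' 0 <= n%:R * z j' 0 by rewrite ler_peMl//; lra.
  by nra.
have [[j' [zj' yj']]|nz] := pselect (exists j', z j' 0 < 0 /\ (x + a *: h) j' 0 = 0).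
  by left; exists j'.
right; split=> [j' zj'|].
  rewrite lt_neqAle fyA andbT eq_sym; apply/eqP => yj'; apply: nz.
  by exists j'.
(* The blocking coordinate has [z_j >= 0], and [x_j + h_j >= z_j] by conformality, so it cannot
   block before length 1. *)
have zj : 0 <= z j 0.
  by rewrite leNgt; apply/negP => zj; apply: nz; exists j; rewrite !mxE.
have a1 : 1 <= a.
  by move: (hd j); rewrite /between !mxE => /orP[]/andP[? ?]; nra.
have : n%:R * (a * h i 0) <= n%:R * h i 0 by rewrite ler_pM2l ?ltr0n//; nra.
by rewrite !mxE; lra.
Qed.

(** * Concatenating steps into phases and walks *)

Inductive circuit_reach {R : realType} {m n : nat} (A : 'M[R]_(m, n))
    (b : 'cV[R]_m) : nat -> 'cV[R]_n -> 'cV[R]_n -> Prop :=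
| reach_refl x : circuit_reach A b 0 x x
| reach_step T x y z : circuit_step A b x y -> circuit_reach A b T y z ->
    circuit_reach A b T.+1 x z.

Lemma reach_trans {R : realType} {m n : nat} (A : 'M[R]_(m, n)) (b : 'cV[R]_m)
    (S T : nat) (x y z : 'cV[R]_n) :
  circuit_reach A b S x y -> circuit_reach A b T y z ->
  circuit_reach A b (S + T) x z.
Proof.
elim=> {S x y} [//|S x x' y st _ IH] /IH; rewrite addSn; exact: reach_step.
Qed.

Lemma reach_walk {R : realType} {m n : nat} (A : 'M[R]_(m, n)) (b : 'cV[R]_m)
    (T : nat) (x y : 'cV[R]_n) :
  circuit_reach A b T x y -> feasible A b x ->
  exists w, [/\ circuit_walk A b T w, w 0%N = x & w T = y].
Proof.
elim=> {T x y} [x|T x x' y st _ IH] fx.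
  by exists (fun=> x); split => //; split.
have /IH[w [[wf ws] w0 wT]] : feasible A b x'.
  by case: st => h [a [_ _ ? _ ->]].
exists (fun t => if t is t'.+1 then w t' else x); split => //.
split=> [[//|t]|[_|t]]; [exact: wf| |exact: ws].
by rewrite w0.
Qed.

(** Until some coordinate with [z_j < 0] vanishes, each step contracts [x_i - z_i] by [(n - 1) / n].
    Feasibility keeps this quantity at least [- z_i], so [t] contractions are impossible. *)
Lemma reach_negative {R : realType} {m n : nat} (A : 'M[R]_(m, n))
    (b : 'cV[R]_m) (z : 'cV[R]_n) (i : 'I_n) (t : nat) (x : 'cV[R]_n) :
  A *m z = b -> z i 0 < 0 ->
  feasible A b x -> (forall j, z j 0 < 0 -> 0 < x j 0) ->
  (n%:R - 1) ^+ t * (x i 0 - z i 0) < n%:R ^+ t * - z i 0 ->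
  exists (T : nat) (y : 'cV[R]_n), [/\ (T <= t)%N, circuit_reach A b T x y,
    feasible A b y, (forall j, y j 0 <= Num.max (x j 0) (n%:R * z j 0)) &
    exists2 j, z j 0 < 0 & y j 0 = 0].
Proof.
move=> Az zi; have n0 : (0 < n)%N by apply: leq_ltn_trans (ltn_ord i).
have n1 : 1 <= n%:R :> R by rewrite ler1n.
elim: t x => [|t IH] x fx zx.
  by rewrite !expr0 !mul1r; have [_ /(_ i)] := fx; lra.
have [y [st yx [[j zj yj]|[zy yi]]]] := step_towards A b x z i fx Az zx zi.
  move=> _; exists 1%N, y; split => //; last by exists j.
    exact: reach_step st (reach_refl _ _ _).
  by case: st => h [a [_ _ ? _ ->]].
move=> H; have fy : feasible A b y by case: st => h [a [_ _ ? _ ->]].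
have [|T [y' [Tt r fy' y'y yz]]] := IH y fy zy.
  rewrite -(ltr_pM2l (_ : 0 < n%:R)) ?ltr0n// [ltRHS]mulrA -exprS.
  apply: le_lt_trans H; rewrite mulrCA exprSr -mulrA ler_wpM2l// exprn_ge0//; lra.
exists T.+1, y'; split => //; first exact: reach_step st r.
by move=> j; rewrite (le_trans (y'y j))// ge_max yx le_max lexx orbT.
Qed.

(* With [K = 2n] and [z = y - (x - y) / K], exactly the coordinates with
   [x j 0 > (K + 1) y j 0] are negative in [z]. *)
Lemma reach_zero {R : realType} {m n : nat} (A : 'M[R]_(m, n)) (b : 'cV[R]_m)
    (x y : 'cV[R]_n) (i : 'I_n) (t : nat) :
  feasible A b x -> feasible A b y -> 4 * n%:R * y i 0 < x i 0 ->
  (n%:R - 1) ^+ t * (16 * n%:R) < n%:R ^+ t :> R ->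
  exists (T : nat) (x' : 'cV[R]_n), [/\ (T <= t)%N, circuit_reach A b T x x',
    feasible A b x',
    (forall j, x j 0 <= 2 * n%:R * y j 0 -> x' j 0 <= 2 * n%:R * y j 0) &
    exists2 j, 2 * n%:R * y j 0 < x j 0 & x' j 0 = 0].
Proof.
move=> fx fy yxi nt; have [Ax x0] := fx; have [Ay y0] := fy.
have n1 : 1 <= n%:R :> R by rewrite ler1n; apply: leq_ltn_trans (ltn_ord i).
set z : 'cV[R]_n := y - (2 * n%:R)^-1 *: (x - y).
have Kz j : 2 * n%:R * z j 0 = (2 * n%:R + 1) * y j 0 - x j 0.
  by rewrite !mxE; field; lra.
(* The cap [n z_j] on increasing coordinates does not exceed the threshold [K y_j], so no coordinate
   newly crosses it. *)
have nz j : n%:R * z j 0 <= 2 * n%:R * y j 0.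
  by have := Kz j; have := x0 j; have := y0 j; nra.
have zyx j : z j 0 < 0 -> 2 * n%:R * y j 0 < x j 0.
  move=> zj; have : 2 * n%:R * z j 0 < 0 by rewrite pmulr_rlt0//; lra.
  by rewrite Kz; have := y0 j; lra.
have xi : 0 < x i 0 by apply: le_lt_trans yxi; rewrite mulr_ge0//; lra.
(* As [(2n + 1) y_i <= 3n y_i] and [4n y_i < x_i], at least a quarter of [x_i] survives in
   [2n (- z_i)]. *)
have nzi : x i 0 <= 8 * n%:R * - z i 0.
  have : y i 0 <= n%:R * y i 0 by rewrite ler_peMl.
  by have := Kz i; lra.
have zi : z i 0 < 0 by nra.
have zxi : x i 0 - z i 0 <= 2 * x i 0.
  have : - z i 0 <= n%:R * - z i 0 by rewrite ler_peMl//; lra.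
  have : 0 <= n%:R * y i 0 by rewrite mulr_ge0//; lra.
  by have := y0 i; have := Kz i; lra.
have [|j /zyx||T [x' [Tt r fx' x'x [j zj x'j]]]] :=
  reach_negative A b z i t x _ zi fx.
- by rewrite mulmxBr -scalemxAr mulmxBr Ax Ay subrr scaler0 subr0.
- by apply: le_lt_trans; rewrite mulr_ge0//; lra.
(* The two bounds combine to [x_i - z_i <= 16n (- z_i)], the source of the factor [16n]. *)
- have p0 : 0 <= (n%:R - 1) ^+ t :> R by rewrite exprn_ge0//; lra.
  have : (n%:R - 1) ^+ t * (x i 0 - z i 0) <=
      (n%:R - 1) ^+ t * (16 * n%:R * - z i 0) by rewrite ler_wpM2l//; lra.
  move=> /le_lt_trans; apply; rewrite mulrA ltr_pM2r//; lra.
exists T, x'; split => //; last by exists j => //; exact: zyx.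
by move=> j' xj'; rewrite (le_trans (x'x j'))// ge_max xj' nz.
Qed.

(** Induction on the number of coordinates above [2n y_j]: a phase removes at least one and adds
    none. A phase is started only when some coordinate exceeds the larger threshold [4n y_i]. *)
Lemma reach_dominated {R : realType} {m n : nat} (A : 'M[R]_(m, n))
    (b : 'cV[R]_m) (x y : 'cV[R]_n) (t : nat) :
  feasible A b x -> feasible A b y ->
  (n%:R - 1) ^+ t * (16 * n%:R) < n%:R ^+ t :> R ->
  exists (T : nat) (x' : 'cV[R]_n), [/\ (T <= n * t)%N, circuit_reach A b T x x',
    feasible A b x' & forall i, x' i 0 <= 4 * n%:R * y i 0].
Proof.
move=> fx fy nt; pose D (x : 'cV[R]_n) := [pred i | 2 * n%:R * y i 0 < x i 0].
suff [T [x' [Tt r fx' x'y]]] : exists (T : nat) (x' : 'cV[R]_n),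
    [/\ (T <= #|D x| * t)%N, circuit_reach A b T x x', feasible A b x' &
      forall i, x' i 0 <= 4 * n%:R * y i 0].
  exists T, x'; split => //; apply: leq_trans Tt _; rewrite leq_mul2r.
  by rewrite -[leqRHS]card_ord max_card orbT.
have [N] := ubnP #|D x|; elim: N x fx => // N IH x fx /ltnSE DN.
have [[i yxi]|dom] := pselect (exists i, 4 * n%:R * y i 0 < x i 0); last first.
  exists 0%N, x; split => //; first exact: reach_refl.
  by move=> i; rewrite leNgt; apply/negP => yxi; apply: dom; exists i.
have [T [x' [Tt r fx' x'D [j yxj x'j]]]] := reach_zero A b x y i t fx fy yxi nt.
have DD : (#|D x'| < #|D x|)%N.
  apply: proper_card; apply/properP; split.
    by apply/fintype.subsetP => j'; rewrite !inE !ltNge; apply: contra => /x'D.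
  exists j; rewrite !inE// x'j -leNgt; have [_ y0] := fy.
  by rewrite !mulr_ge0.
have [T' [x'' [Tt' r' fx'' x''y]]] := IH x' fx' (leq_trans DD DN).
exists (T + T')%N, x''; split => //; last exact: reach_trans r r'.
apply: leq_trans (leq_add Tt Tt') _; rewrite -mulSn leq_mul2r DD orbT //.
Qed.

(* A point dominated by a multiple of an optimal [y] is optimal, because the
   segment from it to [y] can be prolonged beyond [y]. *)
Lemma opt_face_dominated {R : realType} {m n : nat} (A : 'M[R]_(m, n))
    (b : 'cV[R]_m) (c x y : 'cV[R]_n) (K : R) :
  0 < K -> feasible A b x -> opt_face A b c y ->
  (forall i, x i 0 <= K * y i 0) -> opt_face A b c x.
Proof.
move=> K0 fx [fy ymin] xKy; split => // y' fy'.
apply: le_trans (ymin _ fy'); have [Ax x0] := fx; have [Ay y0] := fy.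
have dotpE u v (l : R) : dotp c (u + l *: v) = dotp c u + l * dotp c v.
  rewrite /dotp mulr_sumr -big_split; apply: eq_bigr => i _; rewrite !mxE /=; ring.
have : dotp c y <= dotp c (y + K^-1 *: (y + (-1) *: x)).
  apply: ymin; split.
    by rewrite mulmxDr -scalemxAr mulmxDr -scalemxAr Ax Ay scaleN1r subrr scaler0 addr0.
  move=> i; rewrite !mxE.
  have -> : y i 0 + K^-1 * (y i 0 + -1 * x i 0) = K^-1 * (y i 0 + (K * y i 0 - x i 0)).
    by field; rewrite gt_eqF.
  apply: mulr_ge0; first by rewrite invr_ge0 ltW.
  by rewrite addr_ge0// subr_ge0.
by rewrite !dotpE lerDl pmulr_rge0 ?invr_gt0//; lra.
Qed.

(** * Numerical bound on the length of a phase *)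

(** By [1 - 1/n <= exp(-1/n)], any [t > n ln(16n)] suffices. For [n >= 2], [ln(16n) <= 5 ln n], and
    rounding up costs at most [1 <= n ln n]. *)
Lemma phase_length {R : realType} (n : nat) : (2 <= n)%N ->
  exists2 t : nat, (n%:R - 1) ^+ t * (16 * n%:R) < n%:R ^+ t :> R &
    t%:R <= 6 * n%:R * ln n%:R :> R.
Proof.
move=> n2; have n2R : 2 <= n%:R :> R by rewrite ler_nat.
have n0 : 0 < n%:R :> R by lra.
have ln2 : 2^-1 <= ln 2 :> R.
  (* Inverting reduces this to [exp(-1/2) >= 1/2]. *)
  rewrite -ler_expR lnK ?posrE// -[leRHS]invrK -[leLHS]invrK -expRN.
  rewrite lef_pV2 ?posrE ?invr_gt0 ?expR_gt0//.
  by have := expR_ge1Dx (- 2^-1 : R); lra.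
have lnn : ln 2 <= ln n%:R :> R by rewrite ler_ln ?posrE.
have ln16 : ln (16 * n%:R) <= 5 * ln n%:R :> R.
  have -> : 16 = 2 ^+ 4 :> R by ring.
  by rewrite lnM ?posrE ?exprn_gt0// lnXn// -(mulr_natl (ln 2)); lra.
have L0 : 0 <= n%:R * ln (16 * n%:R) :> R.
  by rewrite mulr_ge0 ?ln_ge0//; lra.
have := truncn_itv L0; set t := (X in X%:R <= _ < _) => /andP[tL Lt].
exists t.+1; last first.
  have : n%:R * ln (16 * n%:R) <= n%:R * (5 * ln n%:R) :> R by rewrite ler_pM2l.
  have : n%:R * 2^-1 <= n%:R * ln n%:R :> R by rewrite ler_pM2l//; lra.
  by move=> ? ?; rewrite -natr1; lra.
have en : (n%:R - 1) / n%:R <= expR (- n%:R^-1) :> R.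
  by apply: le_trans (expR_ge1Dx _); rewrite mulrBl divff ?gt_eqF// mul1r.
have : ((n%:R - 1) / n%:R) ^+ t.+1 < (16 * n%:R)^-1 :> R.
  apply: (@le_lt_trans _ _ (expR (- n%:R^-1) ^+ t.+1)).
    by rewrite lerXn2r ?nnegrE ?expR_ge0// divr_ge0//; lra.
  rewrite -expRM_natr -[ltRHS]lnK ?posrE ?invr_gt0 ?mulr_gt0// ltr_expR.
  rewrite lnV ?posrE ?mulr_gt0// mulNr ltrN2 [ltRHS]mulrC ltr_pdivlMr//; lra.
by rewrite expr_div_n ltr_pdivrMr ?exprn_gt0// [ltRHS]mulrC ltr_pdivlMr ?mulr_gt0.
Qed.

(** * Existence of an optimal point by compactness *)

(** Compactness is argued on row vectors; this transports boundedness from columns. *)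
Lemma ler_norm_trmx {R : realType} (n : nat) (u : 'rV[R]_n) : `|u| <= `|u^T|.
Proof.
rewrite [leLHS]/Num.Def.normr /= mx_normrE; apply/bigmax_leP; split => // -[i j] _ /=.
rewrite [leRHS]/Num.Def.normr /= mx_normrE; apply/bigmax_geP; right.
by exists (j, i) => //=; rewrite mxE.
Qed.

Lemma dotp_trmx_continuous {R : realType} {n : nat} (c : 'cV[R]_n) :
  continuous (fun u : 'rV[R]_n => dotp c u^T).
Proof.
apply: continuous_big => [|i _]; first exact: add_continuous.
under eq_fun do rewrite mxE.
move=> u.
apply: (@cvgM _ _ (nbhs u) _ (fun=> c i 0) (fun u : 'rV[R]_n => u 0 i)).
  exact: cvg_cst.
exact: coord_continuous.
Qed.

(** The set is closed as an intersection of preimages of closed sets under continuous linear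
    functionals. *)
Lemma gap_sublevel_compact {R : realType} {m n : nat} (A : 'M[R]_(m, n))
    (b : 'cV[R]_m) (c : 'cV[R]_n) (g : R) :
  bounded_set (gap_sublevel A b c g) ->
  compact [set u : 'rV[R]_n | gap_sublevel A b c g u^T].
Proof.
move=> [M [Mr MP]]; apply: bounded_closed_compact.
  exists M; split => // M' /MP H u /H; exact: le_trans (ler_norm_trmx _ _).
have E (j : 'I_m) (v : 'cV[R]_n) : (A *m v) j 0 = dotp (row j A)^T v.
  by rewrite mxE; apply: eq_bigr => i _; rewrite !mxE.
have -> : [set u : 'rV[R]_n | gap_sublevel A b c g u^T] =
    (\bigcap_(j in [set: 'I_m])
       (fun u : 'rV[R]_n => dotp (row j A)^T u^T) @^-1` [set r | r = b j 0]) `&`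
    (\bigcap_(i in [set: 'I_n])
       (fun u : 'rV[R]_n => u 0 i) @^-1` [set r | 0 <= r]) `&`
    (fun u : 'rV[R]_n => dotp c u^T) @^-1` [set r | r <= opt_value A b c + g].
  apply/seteqP; split=> u /=.
    move=> [[Au u0] cu]; split=> //; split=> [j _|i _] /=; first by rewrite -E Au.
    by have := u0 i; rewrite mxE.
  move=> [[Au u0] cu]; split=> //; split=> [|i]; last by rewrite mxE; exact: (u0 i I).
  by apply/colP => j; rewrite E; exact: (Au j I).
have cl (f : 'rV[R]_n -> R) (D : set R) :
    continuous f -> closed D -> closed (f @^-1` D).
  by move=> cf; apply: preimage_closed => u _; exact: cf.
apply: closedI; first apply: closedI.
- apply: closed_bigI => j _.
  by refine (cl _ _ _ (@closed_eq R (b j 0))); exact: dotp_trmx_continuous.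
- apply: closed_bigI => i _.
  by refine (cl _ _ _ (@closed_ge R 0)); exact: coord_continuous.
- by refine (cl _ _ _ (@closed_le R (opt_value A b c + g))); exact: dotp_trmx_continuous.
Qed.

Lemma opt_face_nonempty {R : realType} {m n : nat} (A : 'M[R]_(m, n))
    (b : 'cV[R]_m) (c x : 'cV[R]_n) :
  feasible A b x -> bounded_set (gap_sublevel A b c (opt_gap A b c x)) ->
  exists y, opt_face A b c y.
Proof.
move=> fx /gap_sublevel_compact; set S := [set u | _] => compS.
have Sx : S x^T by split; rewrite trmxK//= /opt_gap subrKC.
have [u|u /set_mem Su umin] :=
    compact_EVT_min (f := fun u : 'rV[R]_n => dotp c u^T) (ex_intro _ _ Sx) compS.
  by apply: continuous_subspaceT; exact: dotp_trmx_continuous.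
exists u^T; split=> [|y fy]; first by case: Su.
have [Sy|nSy] := pselect (S y^T).
  by have := umin _ (mem_set Sy); rewrite trmxK.
(* A feasible point outside the sublevel set has a larger objective than every point inside it. *)
have [_ cu] := Su; apply: le_trans cu _; rewrite leNgt; apply/negP => cy.
by apply: nSy; split; rewrite trmxK// ltW.
Qed.

(** * Lower bound on the complexities and the final estimate *)

Lemma SLC_ge1 {R : realType} (eta : R) (phi : R -> R) (g : R) :
  (1 <= SLC eta phi g)%E.
Proof.
apply/ereal_infP => _ [p [psi [_ [p0 _] _ _]] <-].
by rewrite lee_fin ler1n.
Qed.

Theorem theorem2 (R : realType) :
  exists C : R, 0 < C /\
    forall (n : nat), (2 <= n)%N ->
    forall (m : nat) (A : 'M[R]_(m, n)) (b : 'cV[R]_m) (c : 'cV[R]_n),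
      \rank A = m ->
      lp_bounded A b c ->
      (forall g : R, 0 <= g -> bounded_set (gap_sublevel A b c g)) ->
      forall (x : 'cV[R]_n) (g : R),
        feasible A b x -> opt_gap A b c x = g -> 0 <= g ->
        exists (T : nat) (w : nat -> 'cV[R]_n),
          [/\ circuit_walk A b T w, w 0%N = x, opt_face A b c (w T) &
              ((T%:R)%:E <= (C * n%:R ^+ 2 * ln n%:R)%:E *
                 \sum_(i < n) SLC (1 / 2) (max_central_path A b c i) g)%E].
Proof.
(* At most [n] phases of at most [6 n ln n] steps each. *)
exists 6; split=> // n n2 m A b c _ _ bnd x g fx gapx g0.
have [y oy] : exists y, opt_face A b c y.
  by apply: opt_face_nonempty fx _; rewrite gapx; exact: bnd.
have [t nt tn] := @phase_length R n n2.
have [fy _] := oy.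
have [T [x' [Tt /reach_walk/(_ fx)[w [wT w0 wx']] fx' x'y]]] :=
  reach_dominated A b x y t fx fy nt.
have n0 : 0 < n%:R :> R by rewrite ltr0n ltnW.
exists T, w; split => //.
  by rewrite wx'; apply: opt_face_dominated fx' oy x'y; rewrite mulr_gt0.
have TC : T%:R <= 6 * n%:R ^+ 2 * ln n%:R :> R.
  apply: (@le_trans _ _ (n%:R * t%:R)); first by rewrite -natrM ler_nat.
  apply: le_trans (ler_wpM2l (ltW n0) tn) _; rewrite le_eqVlt; apply/orP; left.
  by apply/eqP; ring.
(* The summand of index 0 alone gives 1; the others are nonnegative. *)
have S1 : (1 <= \sum_(i < n) SLC (1 / 2) (max_central_path A b c i) g)%E.
  rewrite (bigD1 (Ordinal (ltnW n2)))//= -[leLHS]adde0 leeD ?SLC_ge1//.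
  by apply: sume_ge0 => i _; exact: le_trans (SLC_ge1 _ _ _).
apply: (@le_trans _ _ (6 * n%:R ^+ 2 * ln n%:R)%:E); first by rewrite lee_fin.
rewrite -[leLHS]mule1 lee_pmul// lee_fin; exact: le_trans TC.
Qed.
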